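(* If $\mathfrak{n}$ is a complex nilpotent Lie algebra with a nontrivial semisimple derivation, then $\mathfrak{n}$ is the degeneration of another, non-isomorphic, Lie algebra; that is, there exists a complex Lie algebra $\mathfrak{g}$ of the same dimension as $\mathfrak{n}$ such that $\mathfrak{g}\not\simeq\mathfrak{n}$ and $\mathfrak{g}\rightarrow_{\deg}\mathfrak{n}$.
   Context: All Lie algebras are finite-dimensional over $\mathbb{C}$. Let $\mathcal{L}_n\subseteq\mathbb{C}^{n^3}$ be the algebraic variety of Lie brackets $\mu$ on $\mathbb{C}^n$ (identified with their structure constants). A Lie algebra $(\mathbb{C}^n,\mu)$ is identified with its bracket $\mu$. The group $GL_n(\mathbb{C})$ acts on $\mathcal{L}_n$ by $g\cdot\mu(x,y)=g(\mu(g^{-1}x,g^{-1}y))$, and the orbit $\mathcal{O}(\mu)$ is the isomorphism class of $\mu$. A Lie algebra $\mu$ degenerates to a Lie algebra $\lambda$ (both in $\mathcal{L}_n$), written $\mu\rightarrow_{\deg}\lambda$, if $\lambda\in\overline{\mathcal{O}(\mu)}$, the Zariski closure of the orbit (which coincides with its closure in the usual topology of $\mathbb{C}^{n^3}$); one also says that $\lambda$ is the degeneration of $\mu$. A derivation is semisimple if it is diagonalizable as a linear map over $\mathbb{C}$, and nontrivial if it is nonzero.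
   Formalization: The formal theorem assumes the dimension of the nilpotent Lie algebra is at least 2: in dimension 1 the claim fails, since the abelian line has the semisimple derivation id but every 1-dimensional Lie algebra is isomorphic to it; dimension 0 is vacuous. *)

(* Defs.v *)
From HB Require Import structures.
From mathcomp Require Import all_boot all_order all_algebra.
From mathcomp Require Import reals complex.
From mathcomp Require mpoly.

Set Implicit Arguments.
Unset Strict Implicit.
Unset Printing Implicit Defensive.

Import Order.TTheory GRing.Theory Num.Theory.
Local Open Scope ring_scope.

(* c (i, j, k) is the coefficient of e_k in the product of e_i and e_j, where
   e_0, ..., e_(n-1) is the standard basis of the column space K^n. The type is
   the affine space K^(n^3), whose points are all bilinear products on K^n. *)
Definition sconst (K : fieldType) (n : nat) : Type :=
  {ffun 'I_n * 'I_n * 'I_n -> K}.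

Definition bracket (K : fieldType) (n : nat) (mu : sconst K n)
    (x y : 'cV[K]_n) : 'cV[K]_n :=
  \col_k \sum_i \sum_j x i 0 * y j 0 * mu (i, j, k).

Definition sconst_of (K : fieldType) (n : nat)
    (b : 'cV[K]_n -> 'cV[K]_n -> 'cV[K]_n) : sconst K n :=
  [ffun t => b (delta_mx t.1.1 0) (delta_mx t.1.2 0) t.2 0].

Definition is_lie (K : fieldType) (n : nat) (mu : sconst K n) : Prop :=
  (forall x, bracket mu x x = 0) /\
  (forall x y z, bracket mu x (bracket mu y z) + bracket mu y (bracket mu z x)
                 + bracket mu z (bracket mu x y) = 0).

(* By bilinearity the brackets of basis vectors span [K^n, U]. *)
Definition bracket_full (K : fieldType) (n : nat) (mu : sconst K n)
    (U : {vspace 'cV[K]_n}) : {vspace 'cV[K]_n} :=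
  <<[seq bracket mu x y | x <- vbasis {:'cV[K]_n}, y <- vbasis U]>>%VS.

Definition lower_central (K : fieldType) (n : nat) (mu : sconst K n)
    (k : nat) : {vspace 'cV[K]_n} :=
  iter k (bracket_full mu) fullv.

Definition is_nilpotent (K : fieldType) (n : nat) (mu : sconst K n) : Prop :=
  exists k, lower_central mu k = 0%VS.

(* Matrices act on columns, x |-> D *m x. *)
Definition is_derivation (K : fieldType) (n : nat) (mu : sconst K n)
    (D : 'M[K]_n) : Prop :=
  forall x y, D *m bracket mu x y
              = bracket mu (D *m x) y + bracket mu x (D *m y).

Definition lie_isomorphic (K : fieldType) (n : nat) (mu lambda : sconst K n)
    : Prop :=
  exists2 g : 'M[K]_n, g \in unitmx &
    forall x y, g *m bracket mu x y = bracket lambda (g *m x) (g *m y).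

Definition gl_act (K : fieldType) (n : nat) (g : 'M[K]_n) (mu : sconst K n)
    : sconst K n :=
  sconst_of (fun x y => g *m bracket mu (invmx g *m x) (invmx g *m y)).

Definition gl_orbit (K : fieldType) (n : nat) (mu nu : sconst K n) : Prop :=
  exists2 g : 'M[K]_n, g \in unitmx & nu = gl_act g mu.

(* Polynomials on K^I: the variable 'X_i stands for the coordinate enum_val i. *)
Definition zariski_closure (K : fieldType) (I : finType)
    (S : {ffun I -> K} -> Prop) (a : {ffun I -> K}) : Prop :=
  forall p : mpoly.mpoly #|I| K,
    (forall b, S b -> mpoly.meval (fun i => b (enum_val i)) p = 0) ->
    mpoly.meval (fun i => a (enum_val i)) p = 0.

Definition degenerates_to (K : fieldType) (n : nat) (mu lambda : sconst K n)
    : Prop :=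
  zariski_closure (gl_orbit mu) lambda.

(* Main.v *)
From HB Require Import structures.
Require Import Defs.
From mathcomp Require Import all_boot all_order all_algebra.
From mathcomp Require Import reals complex boolp sequences exp.
From mathcomp Require Import ring lra.
From mathcomp Require mpoly.

Set Implicit Arguments.
Unset Strict Implicit.
Unset Printing Implicit Defensive.

Import Order.TTheory GRing.Theory Num.Theory.
Local Open Scope ring_scope.

(** Let [D] be a nonzero diagonalizable derivation of the nilpotent bracket [mu].
    [D] cannot map into [[n,n]], so there is a linear functional [xi] vanishing on
    [[n,n]] with [xi o D = a xi] and [a <> 0]. Composing the eigenvalues of [D] with
    a real part or an imaginary part and rescaling gives another derivation [W],
    with real eigenvalues (weights) and [xi o W = xi].

    For a derivation [E] of [mu] that commutes with [W] and satisfies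
    [xi o E = c xi], the bracket [mu_t = mu + t (xi /\ E)] satisfies the Jacobi
    identity. For [t > 0] the automorphism [exp(- ln t W)] of [mu] carries [mu_1] to
    [mu_t], so a polynomial vanishing on the orbit of [mu_1] vanishes at all [mu_t]
    with [t > 0], hence at [mu]: [mu_1] degenerates to [mu]. It
    remains to choose [E] with [mu_1] not isomorphic to [mu].

    - If [W] does not vanish on [ker xi], take [E = W]: then [mu_1] is not nilpotent.
    - Otherwise [mu] is the direct product of a central line [<X>] and [ker xi]. A
      variant of Jacobson's construction of outer derivations of nilpotent algebras
      yields an outer derivation [E] of rank one with [E X = 0] and image in
      [ker xi]; the center of [mu_1] is then strictly smaller than that of [mu]. *)

(** * Bilinearity of the bracket *)

Definition adm (K : fieldType) n (mu : sconst K n) (x : 'cV[K]_n) : 'M[K]_n :=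
  \matrix_(k, j) \sum_i x i 0 * mu (i, j, k).

Lemma bracketE (K : fieldType) n (mu : sconst K n) x y :
  bracket mu x y = adm mu x *m y.
Proof.
apply/matrixP => k l; rewrite !mxE exchange_big /=.
apply: eq_bigr => j _; rewrite !mxE mulr_suml; apply: eq_bigr => i _.
by rewrite (ord1 l) mulrAC.
Qed.

Lemma adm_linear (K : fieldType) n (mu : sconst K n) : linear (adm mu).
Proof.
move=> a x y; apply/matrixP => k j; rewrite !mxE mulr_sumr -big_split /=.
by apply: eq_bigr => i _; rewrite !mxE mulrDl mulrA.
Qed.

HB.instance Definition _ (K : fieldType) n (mu : sconst K n) :=
  GRing.isLinear.Build K 'cV[K]_n 'M[K]_n _ (adm mu) (adm_linear mu).

Lemma bracketDl (K : fieldType) n (mu : sconst K n) x x' y :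
  bracket mu (x + x') y = bracket mu x y + bracket mu x' y.
Proof. by rewrite !bracketE linearD mulmxDl. Qed.

Lemma bracketDr (K : fieldType) n (mu : sconst K n) x y y' :
  bracket mu x (y + y') = bracket mu x y + bracket mu x y'.
Proof. by rewrite !bracketE mulmxDr. Qed.

Lemma bracketZl (K : fieldType) n (mu : sconst K n) a x y :
  bracket mu (a *: x) y = a *: bracket mu x y.
Proof. by rewrite !bracketE linearZ -scalemxAl. Qed.

Lemma bracketZr (K : fieldType) n (mu : sconst K n) a x y :
  bracket mu x (a *: y) = a *: bracket mu x y.
Proof. by rewrite !bracketE -scalemxAr. Qed.

Lemma bracketBr (K : fieldType) n (mu : sconst K n) x y y' :
  bracket mu x (y - y') = bracket mu x y - bracket mu x y'.
Proof. by rewrite !bracketE mulmxBr. Qed.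

Lemma bracket_suml (K : fieldType) n (mu : sconst K n) (I : finType)
    (F : I -> 'cV[K]_n) y :
  bracket mu (\sum_i F i) y = \sum_i bracket mu (F i) y.
Proof.
by rewrite bracketE linear_sum mulmx_suml; apply: eq_bigr => i _; rewrite bracketE.
Qed.

Lemma bracket_sumr (K : fieldType) n (mu : sconst K n) (I : finType) x
    (F : I -> 'cV[K]_n) :
  bracket mu x (\sum_i F i) = \sum_i bracket mu x (F i).
Proof.
by rewrite bracketE mulmx_sumr; apply: eq_bigr => i _; rewrite bracketE.
Qed.

Lemma bracket_skew (K : fieldType) n (mu : sconst K n) x y :
  is_lie mu -> bracket mu x y = - bracket mu y x.
Proof.
case=> alt _; apply/eqP; rewrite -addr_eq0; apply/eqP.
by have := alt (x + y); rewrite bracketDl !bracketDr !alt addr0 add0r.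
Qed.

Lemma bracket_delta (K : fieldType) n (mu : sconst K n) i j k :
  bracket mu (delta_mx i 0) (delta_mx j 0) k 0 = mu (i, j, k).
Proof.
rewrite mxE (bigD1 i) //= [X in _ + X]big1 => [|i' ne]; last first.
  by apply: big1 => j' _; rewrite !mxE (negPf ne) !mul0r.
rewrite (bigD1 j) //= [X in _ + X + _]big1 => [|j' ne]; last first.
  by rewrite !mxE (negPf ne) mulr0 mul0r.
by rewrite !mxE !eqxx !mul1r !addr0.
Qed.

Lemma sconst_ext (K : fieldType) n (mu nu : sconst K n) :
  (forall x y, bracket mu x y = bracket nu x y) -> mu = nu.
Proof.
by move=> h; apply/ffunP => -[[i j] k]; rewrite -!bracket_delta h.
Qed.

Lemma cV_sum_delta (K : fieldType) n (x : 'cV[K]_n) :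
  x = \sum_i x i 0 *: delta_mx i 0.
Proof.
apply/matrixP => k l; rewrite (ord1 l) summxE (bigD1 k) //= big1 ?addr0.
  by rewrite !mxE !eqxx mulr1.
by move=> i ne; rewrite !mxE eq_sym (negPf ne) mulr0.
Qed.

Lemma bracket_sconst_of (K : fieldType) n (b : 'cV[K]_n -> 'cV[K]_n -> 'cV[K]_n) :
    (forall y, linear (b^~ y)) -> (forall x, linear (b x)) ->
  forall x y, bracket (sconst_of b) x y = b x y.
Proof.
move=> bl br x y; apply/matrixP => k l; rewrite (ord1 l) mxE.
pose bL y := HB.pack_for {linear 'cV[K]_n -> 'cV[K]_n} (b^~ y)
  (GRing.isLinear.Build K _ _ _ (b^~ y) (bl y)).
pose bR x := HB.pack_for {linear 'cV[K]_n -> 'cV[K]_n} (b x)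
  (GRing.isLinear.Build K _ _ _ (b x) (br x)).
rewrite {2}(cV_sum_delta x) -[b _ y]/(bL y _) linear_sum summxE.
apply: eq_bigr => i _; rewrite linearZ /=.
rewrite {2}(cV_sum_delta y) -[b _ (\sum_ _ _)]/(bR _ _) linear_sum mxE summxE.
rewrite mulr_sumr; apply: eq_bigr => j _.
by rewrite linearZ /= [in RHS]mxE ffunE /= mulrA.
Qed.

(** * Linear functionals and the deformed bracket *)

Definition eval (K : fieldType) n (xi : 'rV[K]_n) (x : 'cV[K]_n) : K :=
  (xi *m x) 0 0.

Lemma evalE (K : fieldType) n (xi : 'rV[K]_n) x : xi *m x = (eval xi x)%:M.
Proof. by rewrite [LHS]mx11_scalar. Qed.

Lemma eval_linear (K : fieldType) n (xi : 'rV[K]_n) : scalar (eval xi).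
Proof. by move=> a x y; rewrite /eval mulmxDr -scalemxAr !mxE. Qed.

HB.instance Definition _ (K : fieldType) n (xi : 'rV[K]_n) :=
  GRing.isLinear.Build K 'cV[K]_n K _ (eval xi) (eval_linear xi).

Definition deform (K : fieldType) n (mu : sconst K n) (xi : 'rV[K]_n)
    (E : 'M[K]_n) (t : K) : sconst K n :=
  sconst_of (fun x y => bracket mu x y
    + t *: (eval xi x *: (E *m y) - eval xi y *: (E *m x))).

Lemma bracket_deform (K : fieldType) n (mu : sconst K n) xi E t x y :
  bracket (deform mu xi E t) x y = bracket mu x y
    + t *: (eval xi x *: (E *m y) - eval xi y *: (E *m x)).
Proof.
have evalP a u v : eval xi (a *: u + v) = a * eval xi u + eval xi v.
  by rewrite linearP.
rewrite bracket_sconst_of // => [{}y|{}x] a u v;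
  rewrite ?bracketDl ?bracketZl ?bracketDr ?bracketZr evalP mulmxDr -scalemxAr.
  move: (bracket _ _ _) (bracket _ _ _) (E *m _) (E *m _) (E *m _) => A B F G H.
  by apply/matrixP=> i j; rewrite !mxE; ring.
move: (bracket _ _ _) (bracket _ _ _) (E *m _) (E *m _) (E *m _) => A B F G H.
by apply/matrixP=> i j; rewrite !mxE; ring.
Qed.

Lemma eval_mulmx (K : fieldType) n (xi : 'rV[K]_n) (A : 'M[K]_n) x :
  eval xi (A *m x) = eval (xi *m A) x.
Proof. by rewrite /eval mulmxA. Qed.

Lemma eval_scale (K : fieldType) n (xi : 'rV[K]_n) c x :
  eval (c *: xi) x = c * eval xi x.
Proof. by rewrite /eval -scalemxAl mxE. Qed.

Definition kills_brackets (K : fieldType) n (mu : sconst K n) (xi : 'rV[K]_n) :=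
  forall x y, eval xi (bracket mu x y) = 0.

(** The part of the Jacobi sum linear in [t] cancels because [E] is a derivation and [xi] kills
    brackets, the quadratic part because [xi o E] is a multiple of [xi]. *)
Lemma deform_lie (K : fieldType) n (mu : sconst K n) xi E c t :
    is_lie mu -> is_derivation mu E -> kills_brackets mu xi ->
    xi *m E = c *: xi ->
  is_lie (deform mu xi E t).
Proof.
move=> lie_mu der kill eig; split=> [x|x y z].
  by rewrite bracket_deform subrr scaler0 addr0 lie_mu.1.
have evE u : eval xi (E *m u) = c * eval xi u by rewrite eval_mulmx eig eval_scale.
have evD u v a b s w : eval xi (bracket mu u v + s *: (a *: (E *m w) - b *: (E *m u)))
    = s * (a * (c * eval xi w) - b * (c * eval xi u)).
  by rewrite linearD linearZ /= linearB !linearZ /= kill !evE add0r.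
rewrite !bracket_deform !evD !bracketDr !bracketZr !bracketBr !bracketZr.
rewrite !mulmxDr !der -!scalemxAr !mulmxBr -!scalemxAr.
have := lie_mu.2 x y z.
move: (bracket mu x (bracket mu y z)) (bracket mu y (bracket mu z x))
  (bracket mu z (bracket mu x y)) => A B C ABC.
have -> : A = - B - C by rewrite -[A](addrK (B + C)) addrA ABC sub0r opprD.
rewrite (bracket_skew (E *m x) y) // (bracket_skew (E *m y) z) //.
rewrite (bracket_skew (E *m z) x) //.
move: (bracket mu x (E *m y)) (bracket mu x (E *m z)) (bracket mu y (E *m x))
  (bracket mu y (E *m z)) (bracket mu z (E *m x)) (bracket mu z (E *m y)).
move: (E *m (E *m x)) (E *m (E *m y)) (E *m (E *m z)).
move: (E *m x) (E *m y) (E *m z) (eval xi x) (eval xi y) (eval xi z).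
by move=> *; apply/matrixP=> i j; rewrite !mxE; ring.
Qed.

(** * Orbits and degeneration *)

Lemma bracket_gl_act (K : fieldType) n (g : 'M[K]_n) (mu : sconst K n) x y :
  bracket (gl_act g mu) x y = g *m bracket mu (invmx g *m x) (invmx g *m y).
Proof.
rewrite bracket_sconst_of // => [{}y|{}x] a u v.
  by rewrite mulmxDr -scalemxAr bracketDl bracketZl mulmxDr -scalemxAr.
by rewrite mulmxDr -scalemxAr bracketDr bracketZr mulmxDr -scalemxAr.
Qed.

Definition is_automorphism (K : fieldType) n (mu : sconst K n) (g : 'M[K]_n) :=
  forall x y, g *m bracket mu x y = bracket mu (g *m x) (g *m y).

(** Transport by [g] fixes [mu] and [E], so it only replaces [xi] by [xi] composed with the inverse
    of [g], which is [t *: xi]. *)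
Lemma gl_act_deform (K : fieldType) n (mu : sconst K n) xi E g t :
    g \in unitmx -> is_automorphism mu g -> g *m E = E *m g ->
    xi = t *: (xi *m g) ->
  gl_act g (deform mu xi E 1) = deform mu xi E t.
Proof.
move=> gU aut comm eig; apply: sconst_ext => x y.
rewrite bracket_gl_act !bracket_deform mulmxDr aut !mulKVmx //; congr (_ + _).
have ev u : eval xi (invmx g *m u) = t * eval xi u.
  by rewrite {1}eig eval_scale -eval_mulmx mulKVmx.
rewrite !ev scale1r mulmxBr -!scalemxAr !(mulmxA g) comm -!mulmxA !mulKVmx //.
by rewrite -!scalerA -scalerBr.
Qed.

(** Along the deformation a polynomial in the structure constants becomes a polynomial in [t]; zeros
    at all positive integers force one at [t = 0], where the bracket is [mu]. *)
Lemma degenerates_to_deform (K : numFieldType) n (lambda mu : sconst K n) xi E :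
    (forall k : nat, gl_orbit lambda (deform mu xi E k.+1%:R)) ->
  degenerates_to lambda mu.
Proof.
move=> orb p vanish.
pose nu := deform mu xi E 1.
have deformE t i : deform mu xi E t i = mu i + t * (nu i - mu i).
  case: i => [[i j] k]; rewrite -!bracket_delta !bracket_deform scale1r.
  move: (_ - _) (bracket _ _ _) => A B; rewrite !mxE; ring.
pose h (i : 'I_#|{: 'I_n * 'I_n * 'I_n}|) : {poly K} :=
  (mu (enum_val i))%:P + 'X * (nu (enum_val i) - mu (enum_val i))%:P.
pose q := mpoly.mmap polyC h p.
have qE t : q.[t] = mpoly.meval (fun i => deform mu xi E t (enum_val i)) p.
  rewrite mpoly.mevalE horner_sum; apply: eq_bigr => m _.
  rewrite hornerM hornerC horner_prod; congr (_ * _); apply: eq_bigr => i _.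
  by rewrite horner_exp !hornerE deformE.
have q0 : q = 0.
  apply/eqP/negPn/negP => q_neq0.
  (* These [size q] distinct roots are one more than the degree of [q] allows. *)
  pose s : seq K := [seq k.+1%:R | k <- iota 0 (size q)].
  have := @max_poly_roots _ q s q_neq0; rewrite size_map size_iota ltnn => roots_s.
  suff : false by []; apply: roots_s.
    apply/allP => _ /mapP[k _ ->]; rewrite rootE qE.
    by rewrite vanish //; apply: orb.
  rewrite map_inj_uniq ?iota_uniq // => k l /eqP.
  by rewrite eqr_nat eqSS => /eqP.
have := qE 0; rewrite q0 horner0 => /esym/eqP /=.
rewrite (mpoly.meval_eq (v2 := fun i => mu (enum_val i))) => [/eqP->//|i].
by rewrite deformE mul0r addr0.
Qed.

(** * Lower central series and separating functionals *)

Lemma mem_bracket_full (K : fieldType) n (mu : sconst K n) (U : {vspace 'cV[K]_n})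
    x y :
  y \in U -> bracket mu x y \in bracket_full mu U.
Proof.
move=> yU; rewrite (coord_vbasis yU) (coord_vbasis (memvf x)).
rewrite bracket_suml memv_suml // => i _; rewrite bracketZl memvZ //.
rewrite bracket_sumr memv_suml // => j _; rewrite bracketZr memvZ // memv_span //.
by apply: allpairs_f; rewrite mem_nth // size_tuple.
Qed.

Lemma bracket_full_ind (K : fieldType) n (mu : sconst K n)
    (U : {vspace 'cV[K]_n}) (Q : 'cV[K]_n -> Prop) :
    Q 0 -> (forall u v, Q u -> Q v -> Q (u + v)) ->
    (forall a u, Q u -> Q (a *: u)) ->
    (forall x y, y \in U -> Q (bracket mu x y)) ->
  forall v, v \in bracket_full mu U -> Q v.
Proof.
move=> Q0 QD QZ Qb v; rewrite /bracket_full; set X := (X in <<X>>%VS) => vX.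
rewrite (coord_span (X := in_tuple X) vX); apply: big_ind => // i _; apply: QZ.
have /allpairsP[[x y] [_ /= yU ->]] : (in_tuple X)`_i \in X by exact: mem_nth.
exact/Qb/vbasis_mem.
Qed.

Lemma iter_bracket_lower_central (K : fieldType) n (mu : sconst K n) x y k :
  iter k (bracket mu x) y \in lower_central mu k.
Proof. by elim: k => [|k IH]; rewrite ?memvf //= mem_bracket_full. Qed.

(** All coordinates of [id - projv U] vanish on [U], and one of them is nonzero at [v]. *)
Lemma separating_functional (K : fieldType) n (U : {vspace 'cV[K]_n}) v :
  v \notin U ->
  exists2 eta : 'rV[K]_n, forall u, u \in U -> eval eta u = 0 & eval eta v != 0.
Proof.
move=> vU; pose f : 'End('cV[K]_n) := (\1 - projv U)%VF.
have fE u : f u = u - projv U u by rewrite add_lfunE opp_lfunE id_lfunE.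
have /matrix0Pn[i [j]] : f v != 0.
  by apply: contraNneq vU; rewrite fE => /subr0_eq ->; rewrite memv_proj.
rewrite (ord1 j) => fvi; pose eta := \row_j f (delta_mx j 0) i 0.
have etaE u : eval eta u = f u i 0.
  rewrite {2}(cV_sum_delta u) linear_sum summxE /eval mxE.
  by apply: eq_bigr => k _; rewrite linearZ !mxE mulrC.
by exists eta => [u uU|]; rewrite etaE // fE projv_id // subrr mxE.
Qed.

(** * Gradings by the eigenvalues of a diagonalizable map *)

Definition dg (K : fieldType) n (P : 'M[K]_n) (c : 'I_n -> K) : 'M[K]_n :=
  invmx P *m diag_mx (\row_j c j) *m P.

Lemma diagonalizable_dg (K : fieldType) n (D : 'M[K]_n) :
  diagonalizable D -> exists P d, P \in unitmx /\ D = dg P d.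
Proof.
case=> P PU /diagonalizable_forPex[d /(simmxPp (stablemx_unit _ PU)) PD].
exists P, (d 0); split=> //; rewrite /dg -mulmxA.
have -> : \row_j d 0 j = d by apply/rowP => j; rewrite mxE.
by rewrite -PD mulKmx.
Qed.

Section Eigenbasis.
Variables (K : fieldType) (n : nat) (P : 'M[K]_n) (PU : P \in unitmx).
Implicit Types (x y : 'cV[K]_n) (c : 'I_n -> K) (mu : sconst K n).

(** Column [j] of [invmx P], an eigenvector of every [dg P c]; the entries of [P *m x] are the
    coordinates of [x] in this basis. *)
Definition ebasis j : 'cV[K]_n := invmx P *m delta_mx j 0.

Lemma coord_ebasis j i : (P *m ebasis j) i 0 = (i == j)%:R.
Proof. by rewrite mulKVmx // mxE andbT. Qed.

Lemma coord_ext x y : (forall i, (P *m x) i 0 = (P *m y) i 0) -> x = y.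
Proof.
move=> h; rewrite -(mulKmx PU x) -(mulKmx PU y); congr (_ *m _).
by apply/colP.
Qed.

Lemma sum_ebasis x : x = \sum_i (P *m x) i 0 *: ebasis i.
Proof.
rewrite -{1}(mulKmx PU x) {1}(cV_sum_delta (P *m x)) mulmx_sumr.
by apply: eq_bigr => i _; rewrite -scalemxAr.
Qed.

Lemma coord_dg c x i : (P *m (dg P c *m x)) i 0 = c i * (P *m x) i 0.
Proof. by rewrite /dg -!mulmxA mulKVmx // mul_diag_mx !mxE. Qed.

Lemma dg_comm c c' : dg P c *m dg P c' = dg P c' *m dg P c.
Proof.
have conjM A B : invmx P *m A *m P *m (invmx P *m B *m P) = invmx P *m (A *m B) *m P.
  by rewrite !mulmxA mulmxK.
by rewrite /dg !conjM diag_mxC.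
Qed.

Lemma dg_scale c x a :
  (forall i, (P *m x) i 0 != 0 -> c i = a) -> dg P c *m x = a *: x.
Proof.
move=> h; apply: coord_ext => i; rewrite coord_dg -scalemxAr [RHS]mxE.
by have [-> |/h ->//] := eqVneq ((P *m x) i 0) 0; rewrite !mulr0.
Qed.

Lemma eval_ebasis (xi : 'rV[K]_n) x :
  eval xi x = \sum_i (P *m x) i 0 * eval xi (ebasis i).
Proof.
by rewrite {1}(sum_ebasis x) linear_sum; apply: eq_bigr => i _; rewrite linearZ.
Qed.

Lemma row_ext (xi eta : 'rV[K]_n) : (forall x, eval xi x = eval eta x) -> xi = eta.
Proof.
move=> h; apply/rowP => j; have := h (delta_mx j 0).
by rewrite /eval -!colE !mxE.
Qed.

Lemma row_dg_scale c (xi : 'rV[K]_n) a :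
  (forall i, eval xi (ebasis i) != 0 -> c i = a) -> xi *m dg P c = a *: xi.
Proof.
move=> h; apply: row_ext => x.
rewrite -eval_mulmx eval_scale !eval_ebasis mulr_sumr; apply: eq_bigr => i _.
rewrite coord_dg; have [-> |/h ->] := eqVneq (eval xi (ebasis i)) 0.
  by rewrite !mulr0.
by rewrite mulrA.
Qed.

(** The group [V] is arbitrary so that complex eigenvalues and real weights both qualify. *)
Definition graded (V : zmodType) mu (d : 'I_n -> V) :=
  forall i j k, (P *m bracket mu (ebasis i) (ebasis j)) k 0 != 0 ->
    d i + d j = d k.

Lemma bracket_ebasis mu x y : bracket mu x y =
  \sum_i \sum_j ((P *m x) i 0 * (P *m y) j 0) *: bracket mu (ebasis i) (ebasis j).
Proof.
rewrite {1}(sum_ebasis x) bracket_suml; apply: eq_bigr => i _.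
rewrite bracketZl {1}(sum_ebasis y) bracket_sumr scaler_sumr.
by apply: eq_bigr => j _; rewrite bracketZr scalerA.
Qed.

Lemma coord_bracket mu x y k : (P *m bracket mu x y) k 0 =
  \sum_i \sum_j (P *m x) i 0 * (P *m y) j 0
    * (P *m bracket mu (ebasis i) (ebasis j)) k 0.
Proof.
rewrite bracket_ebasis mulmx_sumr summxE; apply: eq_bigr => i _.
rewrite mulmx_sumr summxE; apply: eq_bigr => j _.
by rewrite -scalemxAr [LHS]mxE.
Qed.

Lemma graded_derivation mu c : graded mu c -> is_derivation mu (dg P c).
Proof.
move=> gr x y; apply: coord_ext => k.
rewrite coord_dg mulmxDr [RHS]mxE !coord_bracket mulr_sumr -big_split /=.
apply: eq_bigr => i _; rewrite mulr_sumr -big_split /=; apply: eq_bigr => j _.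
rewrite !coord_dg; have [-> |/gr <-] :=
  eqVneq ((P *m bracket mu (ebasis i) (ebasis j)) k 0) 0; ring.
Qed.

Lemma graded_automorphism mu c :
    (forall i j k, (P *m bracket mu (ebasis i) (ebasis j)) k 0 != 0 ->
      c i * c j = c k) ->
  is_automorphism mu (dg P c).
Proof.
move=> gr x y; apply: coord_ext => k.
rewrite coord_dg !coord_bracket mulr_sumr.
apply: eq_bigr => i _; rewrite mulr_sumr; apply: eq_bigr => j _.
rewrite !coord_dg; have [-> |/gr <-] :=
  eqVneq ((P *m bracket mu (ebasis i) (ebasis j)) k 0) 0; ring.
Qed.

Lemma dg_ebasis c j : dg P c *m ebasis j = c j *: ebasis j.
Proof.
apply: dg_scale => i; rewrite coord_ebasis.
by have [->|] := eqVneq i j; rewrite ?eqxx.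
Qed.

Lemma derivation_graded mu c : is_derivation mu (dg P c) -> graded mu c.
Proof.
move=> der i j k; move/(congr1 (fun u => (P *m u) k 0)): (der (ebasis i) (ebasis j)).
rewrite coord_dg !dg_ebasis bracketZl bracketZr -scalerDl -scalemxAr [RHS]mxE.
by move=> h nz; apply: (mulIf nz).
Qed.

Lemma dg_unit c : (forall i, c i != 0) -> dg P c \in unitmx.
Proof.
move=> c0; rewrite !unitmx_mul unitmx_inv PU /= andbT unitmxE det_diag.
by rewrite unitfE; apply/prodf_neq0 => i _; rewrite mxE c0.
Qed.

(** A bracket of weight vectors is homogeneous. With [f] an indicator, [dg P (f \o d)] is the
    projector onto a weight space. *)
Lemma dg_bracket_ebasis (V : zmodType) mu (d : 'I_n -> V) (f : V -> K) i j :
    graded mu d ->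
  dg P (f \o d) *m bracket mu (ebasis i) (ebasis j)
    = f (d i + d j) *: bracket mu (ebasis i) (ebasis j).
Proof. by move=> gr; apply: dg_scale => k /gr /= <-. Qed.

Lemma ebasis_neq0 j : ebasis j != 0.
Proof.
apply/eqP => /(congr1 (fun u => (P *m u) j 0)).
by rewrite coord_ebasis eqxx mulmx0 mxE => /eqP; rewrite oner_eq0.
Qed.

(* If all weight vectors of nonzero weight were brackets, induction on [k] would put
   them into every [lower_central mu k]: in a sum of brackets of weight vectors of
   total weight [d j != 0], each bracket has a factor of nonzero weight. *)
Lemma exists_weight_outside_brackets mu (d : 'I_n -> K) :
    is_lie mu -> is_nilpotent mu -> graded mu d -> (exists i, d i != 0) ->
  exists2 j, d j != 0 & ebasis j \notin lower_central mu 1.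
Proof.
move=> lie_mu [N lcN] gr [i0 di0].
have [/existsP[j /andP[]]|] :=
  boolP [exists j, (d j != 0) && (ebasis j \notin lower_central mu 1)].
  by exists j.
rewrite negb_exists => /forallP noj.
have sub1 j : d j != 0 -> ebasis j \in lower_central mu 1.
  by move=> dj; have := noj j; rewrite dj /= negbK.
suff sub k j : d j != 0 -> ebasis j \in lower_central mu k.
  by have := sub N _ di0; rewrite lcN memv0 (negPf (ebasis_neq0 _)).
elim: k j => [|k IH] j dj; first exact: memvf.
(* The projector onto weight [d j] fixes [ebasis j] and keeps only brackets of total weight
   [d j]. *)
pose f a : K := (a == d j)%:R.
have -> : ebasis j = dg P (f \o d) *m ebasis j.
  by rewrite dg_ebasis /f /= eqxx scale1r.
move: (ebasis j) (sub1 j dj).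
apply: (bracket_full_ind (Q := fun v => dg P (f \o d) *m v
    \in lower_central mu k.+1)) => [|u v uL vL|a u uL|x y _].
- by rewrite mulmx0 mem0v.
- by rewrite mulmxDr memvD.
- by rewrite -scalemxAr memvZ.
rewrite bracket_ebasis mulmx_sumr memv_suml // => a _.
rewrite mulmx_sumr memv_suml // => b _; rewrite -scalemxAr memvZ //.
rewrite dg_bracket_ebasis // /f.
case: eqP => [dab|_]; last by rewrite scale0r mem0v.
rewrite scale1r; have [da|da] := eqVneq (d a) 0.
  by apply/mem_bracket_full/IH; rewrite da add0r in dab; rewrite dab.
by rewrite bracket_skew // memvN; apply/mem_bracket_full/IH.
Qed.

(** A functional separating a weight vector from the brackets is composed with the projector onto
    its weight space. It still kills brackets, since the projector multiplies each bracket of basis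
    vectors by 0 or 1. *)
Lemma exists_eigenfunctional mu (d : 'I_n -> K) :
    is_lie mu -> is_nilpotent mu -> graded mu d -> (exists i, d i != 0) ->
  exists (xi : 'rV[K]_n) j,
    [/\ kills_brackets mu xi, d j != 0, eval xi (ebasis j) != 0 &
        forall i, eval xi (ebasis i) != 0 -> d i = d j].
Proof.
move=> lie_mu nil_mu gr dnz.
have [j dj /separating_functional[eta eta0 etaj]] :=
  exists_weight_outside_brackets lie_mu nil_mu gr dnz.
pose f a : K := (a == d j)%:R.
have xiE i : eval (eta *m dg P (f \o d)) (ebasis i) = f (d i) * eval eta (ebasis i).
  by rewrite -eval_mulmx dg_ebasis linearZ.
exists (eta *m dg P (f \o d)), j; split=> // [x y||i]; last 2 first.
- by rewrite xiE /f eqxx mul1r.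
- by rewrite xiE /f; have [//|_] := eqVneq (d i) (d j); rewrite mul0r eqxx.
rewrite -eval_mulmx bracket_ebasis mulmx_sumr linear_sum big1 // => a _.
rewrite mulmx_sumr linear_sum big1 // => b _.
rewrite -scalemxAr dg_bracket_ebasis // !linearZ /= eta0 ?mulr0 //.
exact/mem_bracket_full/memvf.
Qed.

End Eigenbasis.

(** * Real weights *)

Lemma ex_real_weights (R : realType) n (P : 'M[R[i]]_n) (mu : sconst R[i] n)
    (d : 'I_n -> R[i]) (xi : 'rV[R[i]]_n) j :
    graded P mu d -> d j != 0 ->
    (forall i, eval xi (ebasis P i) != 0 -> d i = d j) ->
  exists2 w : 'I_n -> R,
    graded P mu w & forall i, eval xi (ebasis P i) != 0 -> w i = 1.
Proof.
move=> gr dj xiE.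
(* Any additive [l] preserves the grading; dividing by [l (d j)] gives [xi] weight 1. *)
suff [l lD lj] : exists2 l : R[i] -> R, {morph l : x y / x + y} & l (d j) != 0.
  exists (fun i => l (d i) / l (d j)) => [i i' k /gr <-|i /xiE ->].
    by rewrite lD mulrDl.
  by rewrite divff.
have [re0|] := eqVneq (complex.Re (d j)) 0; last first.
  by exists (@complex.Re R) => // -[? ?] [].
exists (@complex.Im R) => [[? ?] []//|]; apply: contra dj => /eqP im0.
by rewrite eq_complex re0 im0 !eqxx.
Qed.

Section RealWeights.
Variables (R : realType) (n : nat) (P : 'M[R[i]]_n) (PU : P \in unitmx).
Variables (mu : sconst R[i] n) (w : 'I_n -> R) (gr : graded P mu w).
Variables (xi : 'rV[R[i]]_n) (xi1 : forall i, eval xi (ebasis P i) != 0 -> w i = 1).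

Lemma weight_degeneration (E : 'M[R[i]]_n) :
    (forall f : R -> R[i], dg P (f \o w) *m E = E *m dg P (f \o w)) ->
  degenerates_to (deform mu xi E 1) mu.
Proof.
move=> comm; apply: (degenerates_to_deform (xi := xi) (E := E)) => k.
(* [f a] is [k+1] to the power [- a]: it divides [xi], of weight 1, by [k+1], and so turns the
   parameter 1 into [k+1]. *)
pose f (a : R) : R[i] := (expR (- ln k.+1%:R * a))%:C%C.
have k0 : 0 < k.+1%:R :> R by rewrite ltr0n.
exists (dg P (f \o w)).
  by apply: dg_unit => // i; rewrite /f /= eq_complex /= gt_eqF ?expR_gt0.
apply/esym/gl_act_deform => //.
- by apply: dg_unit => // i; rewrite /f /= eq_complex /= gt_eqF ?expR_gt0.
- apply: graded_automorphism => // i j l /gr /= <-.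
  by rewrite /f /= mulrDr expRD rmorphM.
rewrite (row_dg_scale PU (a := f 1)) => [|i /xi1 /= -> //].
rewrite scalerA /f mulr1 expRN lnK // -(rmorph_nat (real_complex R)) -rmorphM /=.
by rewrite divff ?gt_eqF // scale1r.
Qed.

Definition wmx : 'M[R[i]]_n := dg P (fun i => (w i)%:C%C).

Lemma wmx_comm (f : R -> R[i]) : dg P (f \o w) *m wmx = wmx *m dg P (f \o w).
Proof. exact: dg_comm. Qed.

Lemma xi_wmx : xi *m wmx = 1 *: xi.
Proof. by apply: row_dg_scale => // i /xi1 ->. Qed.

(** Since [ad X] raises weights by 1, coordinate [j] of the bracket only sees coordinates of [y] of
    weight [w j - 1]. *)
Lemma coord_bracket_weight1 X y j :
    (forall i, (P *m X) i 0 != 0 -> w i = 1) ->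
    (forall i, 1 + w i = w j -> (P *m y) i 0 = 0) ->
  (P *m bracket mu X y) j 0 = 0.
Proof.
move=> X1 y0; rewrite coord_bracket // big1 // => i _; rewrite big1 // => l _.
have [-> |/X1 wi] := eqVneq ((P *m X) i 0) 0; first by rewrite !mul0r.
have [-> |/gr] := eqVneq ((P *m bracket mu (ebasis P i) (ebasis P l)) j 0) 0.
  by rewrite mulr0.
by rewrite wi => /y0 ->; rewrite mulr0 mul0r.
Qed.

Lemma iso_iter (la nu : sconst R[i] n) g X u N :
    (forall x y, g *m bracket la x y = bracket nu (g *m x) (g *m y)) ->
  g *m iter N (bracket la X) u = iter N (bracket nu (g *m X)) (g *m u).
Proof. by move=> gP; elim: N => //= N <-. Qed.

(* The operator [y |-> [X, y] + wmx y] on the kernel of [xi] acts by the nonzero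
   scalar [b] on the lowest weight component of [u], since [X] raises weights. *)
Lemma deform_wmx_not_iso X v :
    is_nilpotent mu -> eval xi X = 1 ->
    (forall i, (P *m X) i 0 != 0 -> w i = 1) ->
    kills_brackets mu xi -> eval xi v = 0 -> wmx *m v != 0 ->
  ~ lie_isomorphic (deform mu xi wmx 1) mu.
Proof.
move=> [N lcN] xiX X1 kill xiv wv [g gU iso].
have [j] : exists j, (P *m (wmx *m v)) j 0 != 0.
  apply/existsP; apply: contraR wv; rewrite negb_exists => /forallP h.
  apply/eqP/(coord_ext PU) => i; rewrite mulmx0 [RHS]mxE.
  by apply/eqP; rewrite -[_ == _]negbK.
rewrite coord_dg // mulf_eq0 negb_or => /andP[b0 vj].
pose f a : R[i] := (a == w j)%:R.
pose u := dg P (f \o w) *m v.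
have uE i : (P *m u) i 0 = f (w i) * (P *m v) i 0 by rewrite coord_dg.
have xiu : eval xi u = 0.
  rewrite eval_mulmx (row_dg_scale PU (a := f 1)) => [|i /xi1 /= -> //].
  by rewrite eval_scale xiv mulr0.
have wX : wmx *m X = X.
  by rewrite (dg_scale PU (a := 1)) ?scale1r // => i /X1 ->.
(* Iterates stay in the kernel of [xi], have no component of weight below [w j], and see their part
   of weight [w j] multiplied by [w j] each time. *)
have inv k : let y := iter k (bracket (deform mu xi wmx 1) X) u in
    [/\ eval xi y = 0, forall i, w i < w j -> (P *m y) i 0 = 0 &
        forall i, w i = w j -> (P *m y) i 0 = (w j)%:C%C ^+ k * (P *m v) i 0].
  elim: k => [|k /= [xiy lowy wy]].
    split=> // i wi; rewrite uE /f; last by rewrite wi eqxx.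
    by rewrite lt_eqF // mul0r.
  move: (iter k _ u) xiy lowy wy => y xiy lowy wy.
  have -> : bracket (deform mu xi wmx 1) X y = bracket mu X y + wmx *m y.
    by rewrite bracket_deform scale1r xiX xiy scale1r scale0r subr0.
  split=> [|i wi|i wi].
  - by rewrite linearD /= kill add0r eval_mulmx xi_wmx eval_scale xiy mulr0.
  - rewrite mulmxDr mxE coord_bracket_weight1 // => [|l wl].
      by rewrite add0r coord_dg // lowy // mulr0.
    by apply: lowy; lra.
  rewrite mulmxDr mxE coord_bracket_weight1 // => [|l wl].
    by rewrite add0r coord_dg // wy // wi exprS mulrA.
  by apply: lowy; lra.
(* The isomorphism carries this [ad X] to [ad (g X)] for [mu], whose [N]-th power is zero. *)
have yN0 : iter N (bracket (deform mu xi wmx 1) X) u = 0.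
  have := iter_bracket_lower_central mu (g *m X) (g *m u) N.
  by rewrite lcN memv0 -(iso_iter _ _ _ iso) => /eqP /(canRL (mulKmx gU)) ->;
    rewrite mulmx0.
have [_ _ /(_ j erefl)] := inv N; rewrite yN0 mulmx0 mxE => /esym/eqP.
rewrite mulf_eq0 (negPf vj) orbF expf_eq0 => /andP[_ b00].
by rewrite b00 in b0.
Qed.

End RealWeights.

(** * Splitting off a central line: a rank-one outer derivation *)

Lemma ex_ker_functional (K : fieldType) n (xi : 'rV[K]_n) :
  (2 <= n)%N -> exists2 v : 'cV[K]_n, v != 0 & eval xi v = 0.
Proof.
move=> n2; pose v := nz_row (kermx xi^T).
have vK : (v <= kermx xi^T)%MS by apply: nz_row_sub.
exists v^T.
  rewrite trmx_eq0 nz_row_eq0 -mxrank_eq0 mxrank_ker subn_eq0 -ltnNge.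
  by apply: leq_trans n2; rewrite ltnS rank_leq_col.
by rewrite /eval -[xi *m _]trmxK trmx_mul trmxK (sub_kermxP vK) trmx0 mxE.
Qed.

Section SplitCentralLine.
Variables (K : fieldType) (n : nat) (n_ge2 : (2 <= n)%N) (mu : sconst K n).
Variables (lie_mu : is_lie mu) (nil_mu : is_nilpotent mu).
Variables (xi : 'rV[K]_n) (X : 'cV[K]_n).
Hypotheses (kill : kills_brackets mu xi) (xiX : eval xi X = 1).
Hypothesis central : forall y, bracket mu X y = 0.

Lemma bracket_central y : bracket mu y X = 0.
Proof. by rewrite bracket_skew // central oppr0. Qed.

(** If the brackets and the central [X] spanned everything, the derived algebra would equal all
    later terms of the lower central series, hence vanish, leaving only the line [<X>], against
    [n >= 2]. *)
Lemma ex_functional_killing_X : exists (eta : 'rV[K]_n) Y,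
  [/\ kills_brackets mu eta, eval eta X = 0 & eval eta Y = 1].
Proof.
have [N lcN] := nil_mu.
pose U := (lower_central mu 1 + <[X]>)%VS.
have [/subvP fullU|/subvPn[v _ /separating_functional[eta etaU etav]]] :=
  boolP (fullv <= U)%VS; last first.
  exists eta, ((eval eta v)^-1 *: v); split=> [x y||].
  - apply/etaU/(subvP (addvSl _ <[X]>%VS)).
    exact/mem_bracket_full/memvf.
  - exact/etaU/(subvP (addvSr _ <[X]>%VS))/memv_line.
  by rewrite linearZ /= mulVf.
have splitU y : exists2 b, b \in lower_central mu 1 & exists c, y = b + c *: X.
  have /memv_addP[b bL [_ /vlineP[c ->] ->]] : y \in U by apply/fullU/memvf.
  by exists b => //; exists c.
have sub k b : b \in lower_central mu 1 -> b \in lower_central mu k.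
  elim: k b => [|k IH] b; first by rewrite memvf.
  apply: (bracket_full_ind (Q := fun b => b \in lower_central mu k.+1))
    => [|u v uL vL|a u uL|x y _]; rewrite ?mem0v ?memvD ?memvZ //.
  have [c /IH cL [a ->]] := splitU y.
  by rewrite bracketDr bracketZr bracket_central scaler0 addr0 mem_bracket_full.
have [v v0 xiv] := ex_ker_functional xi n_ge2.
have [b /(sub N)] := splitU v.
rewrite lcN memv0 => /eqP -> [c vE]; move: xiv v0.
rewrite vE add0r linearZ /= xiX mulr1 => ->.
by rewrite scale0r eqxx.
Qed.

(** Otherwise each nonzero vector of the kernel of [xi] has a nonzero bracket, again in that kernel,
    and the lower central series never reaches 0. *)
Lemma ex_central_in_ker :
  exists z, [/\ z != 0, eval xi z = 0 & forall y, bracket mu z y = 0].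
Proof.
have [N lcN] := nil_mu; apply: contrapT => noz.
suff [z [zN z0 _]] : exists z, [/\ z \in lower_central mu N, z != 0 & eval xi z = 0].
  by move: zN z0; rewrite lcN memv0 => ->.
elim: N {lcN} => [|k [z [zk z0 xiz]]].
  by have [v v0 xiv] := ex_ker_functional xi n_ge2; exists v; rewrite memvf.
have [y yz] : exists y, bracket mu y z != 0.
  apply: contrapT => noy; apply: noz; exists z; split=> // y.
  apply/eqP/negPn/negP => zy; apply: noy; exists y.
  by rewrite bracket_skew // oppr_eq0.
by exists (bracket mu y z); rewrite kill mem_bracket_full.
Qed.

(* The derivations [z *m eta] come from the [z] in [ker xi] that commute with
   [ker eta]. If all of them were inner, [ad Y] with [eta Y = 1] would be a nilpotent
   surjection of the nonzero space of these [z] onto itself. *)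
Lemma ex_outer_derivation : exists (eta : 'rV[K]_n) z,
  [/\ eval eta X = 0, eval xi z = 0, z != 0,
      is_derivation mu (z *m eta) &
      ~ exists u, forall y, bracket mu u y = eval eta y *: z].
Proof.
have [N lcN] := nil_mu.
have [eta [Y [killeta etaX etaY]]] := ex_functional_killing_X.
have [z0 [z0_neq0 xiz0 z0_central]] := ex_central_in_ker.
pose Z z := eval xi z = 0 /\ forall y, eval eta y = 0 -> bracket mu z y = 0.
have [z [Zxi Zeta] outer] : exists2 z, Z z &
    ~ exists u, forall y, bracket mu u y = eval eta y *: z.
  apply: contrapT => allinner.
  suff sub k z : Z z -> z \in lower_central mu k.
    have := sub N z0 (conj xiz0 (fun y _ => z0_central y)).
    by rewrite lcN memv0 (negPf z0_neq0).
  elim: k z => [|k IH] z Zz; first exact: memvf.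
  have [u uE] : exists u, forall y, bracket mu u y = eval eta y *: z.
    by apply: contrapT => nou; apply: allinner; exists z.
  (* Removing a multiple of the central [X] puts [u] in the kernel of [xi] without changing its
     brackets. *)
  pose u' := u - eval xi u *: X.
  have u'E y : bracket mu u' y = eval eta y *: z.
    rewrite bracket_skew // bracketBr bracketZr bracket_central scaler0 subr0.
    by rewrite -bracket_skew.
  have Zu' : Z u'.
    split=> [|y etay]; last by rewrite u'E etay scale0r.
    by rewrite linearB linearZ /= xiX mulr1 subrr.
  have -> : z = - bracket mu Y u' by rewrite -bracket_skew // u'E etaY scale1r.
  by rewrite memvN mem_bracket_full //; apply: IH.
exists eta, z; split=> //.
  apply/eqP => z_eq0; apply: outer; exists 0 => y.
  by rewrite z_eq0 scaler0 bracketE linear0 mul0mx.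
have EE y : z *m eta *m y = eval eta y *: z by rewrite -mulmxA evalE mul_mx_scalar.
(* [z] commutes with [y - eval eta y *: Y], which lies in the kernel of [eta]. This makes the two
   terms of the Leibniz rule cancel. *)
have zE y : bracket mu z y = eval eta y *: bracket mu z Y.
  apply/eqP; rewrite -subr_eq0 -bracketZr -bracketBr Zeta //.
  by rewrite linearB linearZ /= etaY mulr1 subrr.
move=> x y; rewrite !EE killeta scale0r bracketZl bracketZr.
rewrite [bracket mu x z]bracket_skew //.
by rewrite (zE x) (zE y) scalerN !scalerA [eval eta y * _]mulrC subrr.
Qed.

Definition lie_center (nu : sconst K n) : {vspace 'cV[K]_n} := lker (linfun (adm nu)).

Lemma lie_centerP (nu : sconst K n) x :
  reflect (forall y, bracket nu x y = 0) (x \in lie_center nu).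
Proof.
rewrite memv_ker lfunE; apply: (iffP eqP) => /= [x0 y|x0].
  by rewrite bracketE x0 mul0mx.
apply/matrixP => i j; have := congr1 (fun u : 'cV_n => u i 0) (x0 (delta_mx j 0)).
by rewrite bracketE -colE !mxE.
Qed.

Lemma dim_lie_center_iso (nu la : sconst K n) :
  lie_isomorphic nu la -> (\dim (lie_center la) <= \dim (lie_center nu))%N.
Proof.
case=> g gU iso; pose f : 'End('cV[K]_n) := linfun (mulmx g).
have <- := limg_ker_dim f (lie_center nu).
apply: leq_trans (leq_addl _ _); apply/dimvS/subvP => x /lie_centerP xC.
have -> : x = f (invmx g *m x) by rewrite lfunE /= mulKVmx.
apply/memv_img/lie_centerP => y; apply: (can_inj (mulKmx gU)).
by rewrite iso mulKVmx // xC mulmx0.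
Qed.

(** A central element of the deformation lies in the kernel of [xi], as otherwise a multiple of it
    would make the derivation inner; it is then central for [mu]. So the center loses [X]. *)
Lemma deform_outer_not_iso (eta : 'rV[K]_n) z :
    eval eta X = 0 -> z != 0 ->
    (~ exists u, forall y, bracket mu u y = eval eta y *: z) ->
  ~ lie_isomorphic (deform mu xi (z *m eta) 1) mu.
Proof.
move=> etaX z0 outer /dim_lie_center_iso dimC.
pose la := deform mu xi (z *m eta) 1.
have laE u y : bracket la u y = bracket mu u y
    + (eval xi u *: (eval eta y *: z) - eval xi y *: (eval eta u *: z)).
  by rewrite bracket_deform scale1r -!mulmxA !evalE !mul_mx_scalar.
have laC u : u \in lie_center la -> eval xi u = 0 /\ forall y, bracket mu u y = 0.
  move/lie_centerP => uC.
  have etau : eval eta u *: z = 0.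
    have := uC X; rewrite laE bracket_central etaX xiX !scale0r scaler0 scale1r.
    by rewrite !sub0r => /eqP; rewrite oppr_eq0 => /eqP.
  have uE y : bracket mu u y = - (eval xi u *: (eval eta y *: z)).
    by apply/eqP; rewrite -addr_eq0 -(uC y) laE etau scaler0 subr0.
  suff xiu : eval xi u = 0 by split=> // y; rewrite uE xiu scale0r oppr0.
  apply/eqP/negPn/negP => xiu; apply: outer.
  exists (- (eval xi u)^-1 *: u) => y.
  by rewrite bracketZl uE scalerN scaleNr opprK !scalerA mulrA mulVf // mul1r.
have XC : X \in lie_center mu by apply/lie_centerP.
have : lie_center la == lie_center mu.
  by rewrite eqEdim dimC andbT; apply/subvP => u /laC[_ /lie_centerP].
move/eqP/vspaceP/(_ X); rewrite XC => /laC[]; rewrite xiX => /eqP.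
by rewrite oner_eq0.
Qed.

End SplitCentralLine.

(** * Choice of the derivation *)

Theorem theorem1 (R : realType) (n : nat) (n_ge2 : (2 <= n)%N)
    (mu : sconst R[i] n) (mu_lie : is_lie mu) (mu_nil : is_nilpotent mu)
    (mu_der : exists D : 'M[R[i]]_n,
       [/\ is_derivation mu D, diagonalizable D & D != 0]) :
  exists lambda : sconst R[i] n,
    [/\ is_lie lambda, ~ lie_isomorphic lambda mu & degenerates_to lambda mu].
Proof.
have [D [der /diagonalizable_dg[P [d [PU DE]]] D0]] := mu_der.
rewrite {}DE in der D0; have grd := derivation_graded PU der.
have dnz : exists i, d i != 0.
  apply/existsP; apply: contraR D0; rewrite negb_exists => /forallP d0.
  rewrite /dg [\row_j _](_ : _ = 0) ?linear0 ?mulmx0 ?mul0mx //.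
  by apply/rowP => j; rewrite !mxE; apply/eqP/negPn.
have [xi [j [kill dj xij xid]]] := exists_eigenfunctional PU mu_lie mu_nil grd dnz.
have [w grw xi1] := ex_real_weights grd dj xid.
have [X xiX X1] : exists2 X, eval xi X = 1 & forall i, (P *m X) i 0 != 0 -> w i = 1.
  exists ((eval xi (ebasis P j))^-1 *: ebasis P j) => [|i].
    by rewrite linearZ /= mulVf.
  rewrite -scalemxAr mxE coord_ebasis // mulf_eq0 negb_or => /andP[_].
  by have [->|_] := eqVneq i j; [move=> _; apply: xi1 | rewrite eqxx].
have der_w : is_derivation mu (wmx P w).
  by apply: graded_derivation => // i k l /grw <-; rewrite rmorphD.
have [ker_w|/existsNP[v /not_implyP[xiv /eqP wv]]] :=
    pselect (forall v, eval xi v = 0 -> wmx P w *m v = 0); last first.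
  exists (deform mu xi (wmx P w) 1); split.
  - exact: deform_lie mu_lie der_w kill (xi_wmx PU xi1).
  - exact: (deform_wmx_not_iso PU grw xi1 mu_nil xiX X1 kill xiv wv).
  - apply: (weight_degeneration PU grw xi1) => f; exact: (wmx_comm PU w f).
have wX : wmx P w *m X = X.
  by rewrite (dg_scale PU (a := 1)) ?scale1r // => i /X1 ->.
(* [W] kills the kernel of [xi] and fixes [X], so it has rank one. *)
have wE v : wmx P w *m v = eval xi v *: X.
  have -> : eval xi v *: X = wmx P w *m (eval xi v *: X) by rewrite -scalemxAr wX.
  apply/eqP; rewrite -subr_eq0 -mulmxBr ker_w //.
  by rewrite linearB linearZ /= xiX mulr1 subrr.
(* In the Leibniz rule for [W] at [X] and [y] the left side is 0 and the right side reduces to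
   [[X, y]]. *)
have central y : bracket mu X y = 0.
  have := der_w X y; rewrite !wE kill xiX scale0r scale1r bracketZr.
  by rewrite mu_lie.1 scaler0 addr0.
have [eta [z [etaX xiz z0 derE outer]]] :=
  ex_outer_derivation n_ge2 mu_lie mu_nil kill xiX central.
exists (deform mu xi (z *m eta) 1); split.
- apply: (deform_lie (c := 0)) => //.
  by rewrite mulmxA evalE xiz mul_scalar_mx !scale0r.
- exact: (deform_outer_not_iso mu_lie xiX central etaX z0 outer).
(* Both [z] and [eta] have weight 0, as [W z = xi(z) X = 0] and
   [w i * eta(e_i) = xi(e_i) * eta(X) = 0]; so both products equal [f 0] times [z *m eta]. *)
apply: (weight_degeneration PU grw xi1) => f.
rewrite mulmxA (dg_scale PU (a := f 0)) => [|i zi /=].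
  rewrite -mulmxA (row_dg_scale PU (a := f 0)) -?scalemxAl -?scalemxAr // => i etai /=.
  have := congr1 (eval eta) (wE (ebasis P i)).
  rewrite dg_ebasis // !linearZ /= etaX mulr0 => /eqP.
  by rewrite mulf_eq0 (negPf etai) orbF => /eqP[->].
have /eqP : (w i)%:C%C * (P *m z) i 0 = 0.
  rewrite -(coord_dg PU (fun k => (w k)%:C%C)) -/(wmx P w) wE xiz scale0r mulmx0.
  by rewrite mxE.
by rewrite mulf_eq0 (negPf zi) orbF => /eqP[->].
Qed.
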